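(* Let $\delta\in(0,n]$. Then $$L^\infty(\mathbb R^n,\mathcal H_\infty^\delta)\subsetneqq \mathrm{BLO}(\mathbb R^n,\mathcal H_\infty^\delta)\subsetneqq \mathrm{BMO}(\mathbb R^n,\mathcal H_\infty^\delta).$$
   Context: A cube $Q\subset\mathbb R^n$ is always left-open and right-closed with sides parallel to the coordinate axes; $l(Q)$ is its edge length. For $\delta\in(0,n]$ and $E\subset\mathbb R^n$ the Hausdorff content is $\mathcal H_\infty^\delta(E)=\inf\{\sum_i l(Q_i)^\delta: E\subset\bigcup_iQ_i\}$, the infimum over all finite or countable coverings by cubes. For any (not necessarily measurable) $f\ge0$, the Choquet integral is $\int_E f\,d\mathcal H_\infty^\delta=\int_0^\infty\mathcal H_\infty^\delta(\{x\in E:f(x)>t\})\,dt$. $L^1_{\rm loc}(\mathbb R^n,\mathcal H_\infty^\delta)$ is the set of functions with $\int_K|f|\,d\mathcal H_\infty^\delta<\infty$ for every compact $K$. All functions are real-valued. $L^\infty(\mathbb R^n,\mathcal H_\infty^\delta)$ is the set of $f$ with $\|f\|_{L^\infty(\mathbb R^n,\mathcal H_\infty^\delta)}=\inf\{t\in(0,\infty):\mathcal H_\infty^\delta(\{x\in\mathbb R^n:|f(x)|>t\})=0\}<\infty$. For a cube $Q$, $\operatorname{ess\,inf}_{y\in Q}f(y)=\inf\{t\in\mathbb R:\mathcal H_\infty^\delta(\{x\in Q:f(x)<t\})>0\}$. $\mathrm{BLO}(\mathbb R^n,\mathcal H_\infty^\delta)$ is the set of $f\in L^1_{\rm loc}(\mathbb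 R^n,\mathcal H_\infty^\delta)$ with $\sup_Q\frac1{\mathcal H_\infty^\delta(Q)}\int_Q|f(x)-\operatorname{ess\,inf}_{y\in Q}f(y)|\,d\mathcal H_\infty^\delta<\infty$ (the quantity is infinite if some essential infimum is $-\infty$). $\mathrm{BMO}(\mathbb R^n,\mathcal H_\infty^\delta)$ is the set of $f\in L^1_{\rm loc}(\mathbb R^n,\mathcal H_\infty^\delta)$ with $\sup_Q\inf_{c\in\mathbb R}\frac1{\mathcal H_\infty^\delta(Q)}\int_Q|f(x)-c|\,d\mathcal H_\infty^\delta<\infty$. Suprema are over all cubes. *)

(* Defs.v *)
From mathcomp Require Import all_boot all_order all_algebra.
From mathcomp Require Import all_classical all_reals all_analysis.
Import Order.TTheory GRing.Theory Num.Theory.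
Import numFieldNormedType.Exports.

Set Implicit Arguments.
Unset Strict Implicit.
Unset Printing Implicit Defensive.

Local Open Scope classical_set_scope.
Local Open Scope ring_scope.
Local Open Scope ereal_scope.

Record cube (R : realType) (n : nat) := Cube {
  corner : 'rV[R]_n ;
  edge : R ;
  edge_gt0 : (0 < edge)%R }.

Definition cube_set (R : realType) (n : nat) (Q : cube R n) : set 'rV[R]_n :=
  [set x | forall i : 'I_n,
    (corner Q ord0 i < x ord0 i <= corner Q ord0 i + edge Q)%R].

(* The index set [D] of a covering is an arbitrary subset of [nat], hence
   finite or countable. *)
Definition hcontent (R : realType) (n : nat) (delta : R)
    (E : set 'rV[R]_n) : \bar R :=
  ereal_inf [set s | exists (D : set nat) (Q : nat -> cube R n),
    E `<=` \bigcup_(i in D) cube_set (Q i) /\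
    s = \esum_(i in D) ((edge (Q i) `^ delta)%R)%:E].

(* The integrand is allowed to take the value [+oo], so that the oscillation
   defining BLO below is infinite when an essential infimum is [-oo]. The
   function of [t] integrated here is nonincreasing, hence measurable,
   whatever [E] and [f] are. *)
Definition choquet (R : realType) (n : nat) (delta : R)
    (E : set 'rV[R]_n) (f : 'rV[R]_n -> \bar R) : \bar R :=
  \int[lebesgue_measure]_(t in `]0%R, +oo[)
    hcontent delta [set x | E x /\ t%:E < f x].

Definition L1loc (R : realType) (n : nat) (delta : R) :
    set ('rV[R]_n -> R) :=
  [set f | forall K : set 'rV[R]_n, compact K ->
    choquet delta K (fun x => `|f x|%:E) < +oo].

Definition Linfty_norm (R : realType) (n : nat) (delta : R)
    (f : 'rV[R]_n -> R) : \bar R :=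
  ereal_inf [set t%:E | t in
    [set t : R | (0 < t)%R /\ hcontent delta [set x | (t < `|f x|)%R] = 0]].

Definition Linfty (R : realType) (n : nat) (delta : R) :
    set ('rV[R]_n -> R) :=
  [set f | Linfty_norm delta f < +oo].

Definition essinf (R : realType) (n : nat) (delta : R)
    (Q : cube R n) (f : 'rV[R]_n -> R) : \bar R :=
  ereal_inf [set t%:E | t in
    [set t : R | 0 < hcontent delta [set x | cube_set Q x /\ (f x < t)%R]]].

Definition choquet_mean (R : realType) (n : nat) (delta : R)
    (Q : cube R n) (f : 'rV[R]_n -> \bar R) : \bar R :=
  (hcontent delta (cube_set Q))^-1 * choquet delta (cube_set Q) f.

Definition BLO (R : realType) (n : nat) (delta : R) :
    set ('rV[R]_n -> R) :=
  [set f | L1loc delta f /\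
    ereal_sup (range (fun Q : cube R n =>
      choquet_mean delta Q (fun x => `|(f x)%:E - essinf delta Q f|)))
    < +oo].

Definition BMO (R : realType) (n : nat) (delta : R) :
    set ('rV[R]_n -> R) :=
  [set f | L1loc delta f /\
    ereal_sup (range (fun Q : cube R n =>
      ereal_inf (range (fun c : R =>
        choquet_mean delta Q (fun x => `|f x - c|%:E)))))
    < +oo].

(* Main.v *)
(* If H({x in Q : |f - e_Q| > t}) <= B l(Q)^delta e^(- delta t) for all t > 0,
   where e_Q is the essential infimum of f on Q, then f lies in BLO: integrate
   in t and use that H(Q) is comparable to l(Q)^delta. Functions in Linfty
   satisfy this, and so does - ln |x| with the sup norm: its essential infimum
   on Q is its value at the corner p of Q farthest from 0, and the condition
   - ln |x| + ln |p| > t confines x to the cube of radius |p| e^(-t); either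
   |p| <= 2 l(Q), or |x| >= |p| / 2 on Q. This unbounded function separates BLO
   from Linfty, and its opposite ln |x| separates BMO from BLO since its
   essential infimum near 0 is -oo. The lower bound H(Q) >= c l(Q)^delta
   reduces to delta = n, where it follows from compactness and from counting
   grid points. *)
Require Import Defs.
From mathcomp Require Import all_boot all_order all_algebra finmap.
From mathcomp Require Import all_classical all_reals all_analysis.
From mathcomp Require Import measurable_realfun lra.
Import Order.TTheory GRing.Theory Num.Theory.
Import numFieldNormedType.Exports.

Local Open Scope classical_set_scope.
Local Open Scope ring_scope.

(** * Counting grid points in cubes *)

(** If [i] and [j] are the least and greatest indices in [A], then [A] has at most [j - i + 1]
    elements, while [h * (j - i) < s] because both points lie in an interval of length [s]. *)
Lemma card_progression_le (R : realType) (N : nat) (A : {set 'I_N})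
    (p h a s : R) : 0 < h -> 0 <= s ->
  (forall k, k \in A -> a < p + h * (k : nat)%:R < a + s) ->
  #|A|%:R <= s / h + 1.
Proof.
move=> h0 s0 HA.
have [->|[k kA]] := set_0Vmem A.
  by rewrite cards0 addr_ge0// divr_ge0// ltW.
have [i iA imin] := @arg_minnP _ k (mem A) (fun k : 'I_N => k : nat) kA.
have [j jA jmax] := @arg_maxnP _ k (mem A) (fun k : 'I_N => k : nat) kA.
have ij : (i <= j)%N by exact: imin.
have cA : (#|A| <= (j - i).+1)%N.
  rewrite cardE -(size_map val) -(size_iota i (j - i).+1).
  apply: uniq_leq_size; first by rewrite (map_inj_uniq val_inj) enum_uniq.
  move=> _ /mapP[m + ->]; rewrite mem_enum mem_iota => mA.
  by rewrite addnS ltnS subnKC// [(i <= _)%N]imin//=; exact: jmax.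
apply: (@le_trans _ _ (j - i).+1%:R); first by rewrite ler_nat.
rewrite -natr1 lerD2r natrB// ler_pdivlMr//.
have /andP[ia _] := HA _ iA; have /andP[_ js] := HA _ jA.
rewrite mulrC mulrBr; lra.
Qed.

Lemma card_cover_le (T : finType) (I : eqType) (r : seq I) (F : I -> {set T}) :
  (forall x, exists2 i, i \in r & x \in F i) ->
  (#|T| <= \sum_(i <- r) #|F i|)%N.
Proof.
move=> cov; rewrite -sum1_card.
under [leqRHS]eq_bigr do rewrite -sum1_card big_mkcond.
rewrite exchange_big/=; apply: leq_sum => x _; have [i ir xi] := cov x.
by rewrite (big_rem i)//= xi leq_addr.
Qed.

(* A grid of mesh [s / N] has [N ^ n] points in the closed cube, while an open
   cube of edge [l j >= s / N] contains at most [(2 * N * l j / s) ^ n] of them.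
*)
Lemma cube_volume_subadditive (R : realType) (n : nat) (b : 'rV[R]_n) (s : R)
    (D : seq nat) (a : nat -> 'rV[R]_n) (l : nat -> R) :
  0 < s -> (forall j, 0 < l j) ->
  (forall x : 'rV[R]_n,
    (forall i, b ord0 i <= x ord0 i <= b ord0 i + s) ->
    exists2 j, j \in D &
      forall i, a j ord0 i < x ord0 i < a j ord0 i + l j) ->
  s ^+ n <= \sum_(j <- D) (2 * l j) ^+ n.
Proof.
move=> s0 l0 cov.
(* [N] exceeds every [s / l j], so the mesh [h] is at most each edge; the successor keeps [N]
   positive even for an empty [D]. *)
pose N := (\max_(j <- D) Num.bound (s / l j)).+1.
have N0 : 0 < N%:R :> R by rewrite ltr0n.
pose h := s / N%:R; have h0 : 0 < h by rewrite divr_gt0.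
have hl j : j \in D -> h <= l j.
  move=> jD; rewrite ler_pdivrMr// mulrC -ler_pdivrMr//.
  have sl : 0 <= s / l j by rewrite divr_ge0// ltW.
  apply: (le_trans (ltW (archi_boundP sl))); rewrite ler_nat ltnW// ltnS.
  exact: (@leq_bigmax_seq _ _ xpredT (fun j => Num.bound (s / l j))).
pose A j i : {set 'I_N} := [set k : 'I_N |
  a j ord0 i < b ord0 i + h * (k : nat)%:R < a j ord0 i + l j]%SET.
pose S j : {set {dffun forall i : 'I_n, 'I_N}} := setXn (A j).
have SA j : j \in D -> #|S j|%:R <= (2 * l j / h) ^+ n.
  move=> jD; rewrite cardsXn natr_prod.
  rewrite -[X in _ <= _ ^+ X](card_ord n) -prodr_const.
  apply: ler_prod => i _; rewrite ler0n/=.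
  (* The extra [1] of the one-dimensional count is absorbed since [l j / h >= 1]; this is where the
     factor 2 arises. *)
  apply: le_trans (_ : l j / h + 1 <= _); last first.
    have : 1 <= l j / h by rewrite ler_pdivlMr// mul1r hl.
    by rewrite -mulrA; lra.
  apply: (@card_progression_le _ _ _ (b ord0 i) h (a j ord0 i) (l j)) => //.
    exact: ltW.
  by move=> k; rewrite inE.
have cS : (N ^ n <= \sum_(j <- D) #|S j|)%N.
  have -> : (N ^ n)%N = #|{dffun forall i : 'I_n, 'I_N}|.
    by rewrite card_dep_ffun foldrE big_map big_enum/= prod_nat_const !card_ord.
  apply: card_cover_le => k.
  have [i|j jD Hj] := cov (\row_i (b ord0 i + h * (k i : nat)%:R)).
    rewrite mxE lerDl mulr_ge0 ?ler0n ?(ltW h0)//= lerD2l.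
    by rewrite /h mulrAC ler_pdivrMr// ler_pM2l// ler_nat ltnW.
  exists j => //; apply/setXnP => i.
  by rewrite inE; have := Hj i; rewrite mxE.
have : N%:R ^+ n <= \sum_(j <- D) (2 * l j / h) ^+ n.
  rewrite -natrX (le_trans (_ : _ <= (\sum_(j <- D) #|S j|)%:R))//.
    by rewrite ler_nat.
  by rewrite natr_sum !big_seq; apply: ler_sum => j; exact: SA.
have -> : N%:R = s / h by rewrite /h invf_div mulrC divfK ?gt_eqF.
rewrite expr_div_n ler_pdivrMr ?exprn_gt0// => /le_trans; apply.
rewrite mulr_suml; apply: ler_sum => j _.
by rewrite expr_div_n divfK// expf_neq0// gt_eqF.
Qed.

(** * Hausdorff content: monotonicity and the content of a cube *)

Lemma hcontent_le (R : realType) (n : nat) (delta : R) (E F : set 'rV[R]_n) :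
  E `<=` F -> (hcontent delta E <= hcontent delta F)%E.
Proof.
move=> EF; apply: ereal_inf_le_tmp => s [D [Q [FQ ->]]].
by exists D, Q; split => //; exact: subset_trans FQ.
Qed.

Lemma hcontent_ge0 (R : realType) (n : nat) (delta : R) (E : set 'rV[R]_n) :
  (0 <= hcontent delta E)%E.
Proof.
apply: le_ereal_inf_tmp => s [D [Q [_ ->]]].
by apply: esum_ge0 => i _; rewrite lee_fin powR_ge0.
Qed.

Lemma hcontent_le_cube (R : realType) (n : nat) (delta : R)
    (E : set 'rV[R]_n) (Q : cube R n) : E `<=` cube_set Q ->
  (hcontent delta E <= (edge Q `^ delta)%:E)%E.
Proof.
move=> EQ; apply: ereal_inf_lbound; exists [set 0%N], (fun=> Q); split.
  by rewrite bigcup_set1.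
by rewrite esum_set1// lee_fin powR_ge0.
Qed.

Lemma open_box (R : realType) (n : nat) (a : 'rV[R]_n) (l : R) :
  open [set x : 'rV[R]_n | forall i, a ord0 i < x ord0 i < a ord0 i + l].
Proof.
rewrite openE => x ax; apply: (@filter_forall _ _ _ (nbhs x)) => i.
have bi : nbhs (x ord0 i) `]a ord0 i, a ord0 i + l[%classic.
  by apply: open_nbhs_nbhs; split; [exact: itv_open|rewrite /= in_itv/= ax].
apply: (@filterS _ (nbhs x) _ _ _ _ (@coord_continuous R 1 n ord0 i x _ bi)).
by move=> y /=; rewrite in_itv.
Qed.

(** A covering cube with edge at least that of [Q] suffices alone. Otherwise all ratios of edges are
    below 1, so passing from exponent [delta] to [n] only lowers their powers, and a comparison of
    volumes concludes. *)
Lemma hcontent_cube_ge (R : realType) (n : nat) (delta : R) (Q : cube R n) :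
  0 < delta -> delta <= n%:R ->
  (((8 ^+ n)^-1 * edge Q `^ delta)%:E <= hcontent delta (cube_set Q))%E.
Proof.
move=> d0 dn; apply: le_ereal_inf_tmp => _ [D [P [cov ->]]].
set l := edge Q; have l0 : 0 < l by exact: edge_gt0.
have [[j [Dj lj]]|small] := pselect (exists j, D j /\ l <= edge (P j)).
  apply: esum_ge; exists [set j].
    by split; [exact: finite_set1|move=> _ ->].
  rewrite fsbig_set1 lee_fin (le_trans (_ : _ <= l `^ delta))//.
    by rewrite ler_piMl ?powR_ge0// invf_le1 ?exprn_gt0// exprn_ege1// ler1n.
  by rewrite ge0_ler_powR// ?nnegrE ltW// (lt_le_trans l0).
(* The closed upper half-size cube [K] is a compact subset of the left-open [Q], and doubling each
   covering cube from its lower corner gives an open box [U j] containing it. These two factors 2,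
   with that of the grid count, make up [8 ^+ n]. *)
pose b : 'rV[R]_n := \row_i (corner Q ord0 i + l / 2).
pose K := [set x : 'rV[R]_n | forall i,
  `[b ord0 i, b ord0 i + l / 2]%classic (x ord0 i)].
pose U j := [set x : 'rV[R]_n | forall i,
  corner (P j) ord0 i < x ord0 i < corner (P j) ord0 i + 2 * edge (P j)].
have cK : compact K.
  apply: (@rV_compact R n (fun i => `[b ord0 i, b ord0 i + l / 2]%classic)).
  by move=> i; exact: segment_compact.
have KU : K `<=` cover D U.
  move=> x Kx; have /cov[j Dj Pjx] : cube_set Q x.
    move=> i; have := Kx i; rewrite /= in_itv/= mxE => /andP[].
    by rewrite -/l; move=> ? ?; apply/andP; split; lra.
  exists j => // i; have /andP[-> xe] := Pjx i.
  by apply: (le_lt_trans xe); have := edge_gt0 (P j); lra.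
move: cK; rewrite compact_cover => /(_ _ D U _ KU)[j _|D' D'D KD'].
  exact: open_box.
have vol : (l / 2) ^+ n <= \sum_(j <- enum_fset D') (2 * (2 * edge (P j))) ^+ n.
  apply: (@cube_volume_subadditive _ _ b _ _ (fun j => corner (P j))
    (fun j => 2 * edge (P j))).
  - by rewrite divr_gt0.
  - by move=> j; rewrite mulr_gt0// edge_gt0.
  - move=> x bx; have [|j D'j Uj] := KD' x.
      by move=> i; rewrite /= in_itv/= bx.
    by exists j.
apply: esum_ge; exists [set` D'].
  by split; [exact: finite_fset|move=> j /D'D /set_mem].
rewrite fsbig_finite ?set_fsetK//= sumEFin lee_fin.
have ln0 : 0 < l ^+ n by rewrite exprn_gt0.
apply: (@le_trans _ _
    (\sum_(j <- enum_fset D') l `^ delta * (edge (P j) / l) ^+ n)).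
  rewrite -mulr_sumr mulrC ler_pM2l ?powR_gt0//.
  under eq_bigr do rewrite expr_div_n.
  rewrite -mulr_suml ler_pdivlMr// mulrC ler_pdivrMr ?exprn_gt0//.
  move: vol; rewrite expr_div_n ler_pdivrMr ?exprn_gt0// => /le_trans; apply.
  under eq_bigr do rewrite mulrA exprMn.
  rewrite -mulr_sumr [leLHS]mulrAC -exprMn mulrC.
  by rewrite (_ : 2 * 2 * 2 = 8 :> R)//; lra.
rewrite !big_seq; apply: ler_sum => j D'j.
have ej0 := edge_gt0 (P j).
have Pl : edge (P j) <= l.
  rewrite leNgt; apply/negP => lP; apply: small; exists j; split.
    exact: set_mem (D'D _ D'j).
  exact: ltW.
rewrite -[in leRHS](@divfK _ l _ (edge (P j))) ?gt_eqF//.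
rewrite powRM ?divr_ge0 ?(ltW l0) ?(ltW ej0)// mulrC.
rewrite ler_pM2r ?powR_gt0// -powR_mulrn ?divr_ge0 ?(ltW l0) ?(ltW ej0)//.
by apply: ger_powR => //; rewrite divr_gt0//= ler_pdivrMr// mul1r.
Qed.

(** * Choquet integrals and means over a cube *)

(** The integral of a nonnegative function is a supremum over the simple functions below it, so
    monotonicity needs no measurability. The content of superlevel sets can thus be compared with a
    density directly. *)
Lemma ge0_le_integral_nonmeasurable d (T : measurableType d) (R : realType)
    (mu : {measure set T -> \bar R}) (f g : T -> \bar R) :
  (forall x, 0 <= f x)%E -> (forall x, f x <= g x)%E ->
  (\int[mu]_x f x <= \int[mu]_x g x)%E.
Proof.
move=> f0 fg; have g0 x : (0 <= g x)%E by exact: le_trans (fg x).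
rewrite !ge0_integralTE//; apply: ereal_sup_le => _ [h hf <-].
by exists h => // x; exact: le_trans (fg x).
Qed.

(** The assumed bound is [A / delta] times the exponential density of rate [delta], whose total mass
    is 1. *)
Lemma choquet_le_exp (R : realType) (n : nat) (delta : R) (E : set 'rV[R]_n)
    (f : 'rV[R]_n -> \bar R) (A : R) : 0 < delta -> 0 <= A ->
  (forall t : R, (0 < t)%R -> hcontent delta [set x | E x /\ (t%:E < f x)%E] <=
    (A * expR (- delta * t))%R%:E)%E ->
  (choquet delta E f <= (A / delta)%:E)%E.
Proof.
move=> d0 A0 HA; rewrite /choquet integral_mkcond.
apply: (@le_trans _ _
    (\int[lebesgue_measure]_t
       ((A / delta)%:E * (exponential_pdf delta t)%:E))%E).
  apply: ge0_le_integral_nonmeasurable => t.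
    by apply: erestrict_ge0 => ? _; exact: hcontent_ge0.
  rewrite patchE; case: ifPn => [|_]; last first.
    by rewrite -EFinM lee_fin mulr_ge0 ?exponential_pdf_ge0 ?divr_ge0// ltW.
  rewrite inE/= in_itv/= andbT => t0.
  rewrite -EFinM /exponential_pdf patchE ifT; last first.
    by rewrite inE/= in_itv/= andbT ltW.
  by rewrite mulrA divfK ?gt_eqF//; exact: HA.
rewrite ge0_integralZl_EFin//.
- by rewrite integral_exponential_pdf// mule1.
- by move=> t _; rewrite lee_fin exponential_pdf_ge0// ltW.
- by apply: (measurable_EFinP _ _).2; exact: measurable_exponential_pdf.
- by rewrite divr_ge0// ltW.
Qed.

(** Every superlevel set is [E] itself, so a positive constant is integrated over a half-line. This
    covers oscillations around an infinite essential infimum. *)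
Lemma choquet_infty (R : realType) (n : nat) (delta : R) (E : set 'rV[R]_n)
    (f : 'rV[R]_n -> \bar R) :
  (0 < hcontent delta E)%E -> (forall x, E x -> f x = +oo%E) ->
  choquet delta E f = +oo%E.
Proof.
move=> E0 foo; rewrite /choquet.
under eq_integral => t _.
  rewrite (_ : [set x | _] = E); first over.
  by apply/seteqP; split => [x []//|x Ex]; split => //; rewrite foo// ltry.
rewrite integral_cst//= lebesgue_measure_itv/= ltry.
by rewrite gt0_muley.
Qed.

Lemma hcontent_cube_fin (R : realType) (n : nat) (delta : R) (Q : cube R n) :
  0 < delta -> delta <= n%:R ->
  exists2 r, hcontent delta (cube_set Q) = r%:E &
    0 < (8 ^+ n)^-1 * edge Q `^ delta <= r.
Proof.
move=> d0 dn; have := hcontent_cube_ge _ _ _ Q d0 dn.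
have := hcontent_le_cube _ _ delta _ Q (@subset_refl _ _).
case: (hcontent _ _) => [r _ c|//|//].
exists r => //; rewrite -lee_fin c andbT.
by rewrite mulr_gt0 ?invr_gt0 ?exprn_gt0// powR_gt0// edge_gt0.
Qed.

Lemma hcontent_cube_gt0 (R : realType) (n : nat) (delta : R) (Q : cube R n) :
  0 < delta -> delta <= n%:R -> (0 < hcontent delta (cube_set Q))%E.
Proof.
move=> d0 dn; have [r -> /andP[c cr]] := hcontent_cube_fin _ _ _ Q d0 dn.
by rewrite lte_fin (lt_le_trans c).
Qed.

Lemma choquet_mean_le_exp (R : realType) (n : nat) (delta : R) (Q : cube R n)
    (f : 'rV[R]_n -> \bar R) (B : R) : 0 < delta -> delta <= n%:R -> 0 <= B ->
  (forall t : R, (0 < t)%R ->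
    hcontent delta [set x | cube_set Q x /\ (t%:E < f x)%E] <=
    (B * edge Q `^ delta * expR (- delta * t))%R%:E)%E ->
  (choquet_mean delta Q f <= (8 ^+ n * B / delta)%:E)%E.
Proof.
move=> d0 dn B0 HB.
have le0 : 0 < edge Q `^ delta by rewrite powR_gt0// edge_gt0.
have := choquet_le_exp _ _ _ _ _ _ d0 (mulr_ge0 B0 (ltW le0)) HB.
rewrite /choquet_mean.
have [r -> /andP[c cr]] := hcontent_cube_fin _ _ _ Q d0 dn.
have r0 : 0 < r by exact: lt_le_trans cr.
rewrite inver gt_eqF// => chB.
have rV0 : (0 <= r^-1%:E)%E by rewrite lee_fin invr_ge0 ltW.
apply: (le_trans (lee_wpmul2l rV0 chB)).
rewrite -EFinM lee_fin mulrA ler_pM2r ?invr_gt0// mulrC ler_pdivrMr//.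
rewrite [leRHS]mulrAC [leRHS]mulrC; apply: ler_wpM2l => //.
by rewrite -ler_pdivrMl// exprn_gt0.
Qed.

Lemma choquet_mean_infty (R : realType) (n : nat) (delta : R) (Q : cube R n)
    (f : 'rV[R]_n -> \bar R) : 0 < delta -> delta <= n%:R ->
  (forall x, cube_set Q x -> f x = +oo%E) -> choquet_mean delta Q f = +oo%E.
Proof.
move=> d0 dn foo; rewrite /choquet_mean choquet_infty//; last first.
  exact: hcontent_cube_gt0.
have [r -> /andP[c cr]] := hcontent_cube_fin _ _ _ Q d0 dn.
have r0 : 0 < r by exact: lt_le_trans cr.
by rewrite inver gt_eqF// gt0_muley// lte_fin invr_gt0.
Qed.

(** * Exponential decay of the oscillation implies BLO *)

Definition centered_cube (R : realType) (n : nat) (a : 'rV[R]_n) (r : R)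
    (r0 : 0 < r) : cube R n :=
  @Cube R n (\row_i (a ord0 i - r)) (r + r) (addr_gt0 r0 r0).

Lemma coord_le_norm (R : realType) (n : nat) (x : 'rV[R]_n) (i : 'I_n) :
  `|x ord0 i| <= `|x|.
Proof.
rewrite [leRHS]mx_normrE.
exact: (@le_bigmax _ _ _ 0 (fun ij : 'I_1 * 'I_n => `|x ij.1 ij.2|) (ord0, i)).
Qed.

Lemma norm_le_coord (R : realType) (n : nat) (x : 'rV[R]_n) (r : R) :
  0 <= r -> (forall i, `|x ord0 i| <= r) -> `|x| <= r.
Proof.
move=> r0 xr; rewrite [leLHS]mx_normrE; apply/bigmax_leP; split => //.
by case=> i j _ /=; rewrite (ord1 i).
Qed.

Lemma subset_centered_cube (R : realType) (n : nat) (r : R) (r0 : 0 < r)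
    (x : 'rV[R]_n) : `|x| < r -> cube_set (centered_cube _ n 0 r r0) x.
Proof.
move=> xr i /=; rewrite !mxE add0r.
have : `|x ord0 i| < r by exact: le_lt_trans (coord_le_norm _ _ x i) xr.
rewrite ltr_norml => /andP[-> xir]; rewrite addrA addNr add0r /=; exact: ltW.
Qed.

Lemma BLO_exp_decay (R : realType) (n : nat) (delta : R)
    (f : 'rV[R]_n -> R) (B : R) : 0 < delta -> delta <= n%:R -> 1 <= B ->
  (forall Q : cube R n, exists2 e : R, essinf delta Q f = e%:E &
    forall t : R, (0 < t)%R ->
      hcontent delta [set x | cube_set Q x /\ (t < `|f x - e|)%R] <=
      (B * edge Q `^ delta * expR (- delta * t))%R%:E)%E ->
  BLO delta f.
Proof.
move=> d0 dn B1 HB; have B0 : 0 <= B by rewrite (le_trans _ B1).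
split.
  move=> K /(@compact_bounded R)[M [_ KM]].
  (* Boundedness of [K] gives a bound by any number above [M], such as [|M| + 1]; one more unit
     makes the inequality strict. *)
  pose r := `|M| + 2; have r0 : 0 < r by rewrite /r ltr_wpDl.
  have [e _ He] := HB (centered_cube _ n 0 r r0).
  set Q := centered_cube _ _ _ _ _ in He.
  have KQ : K `<=` cube_set Q.
    move=> x Kx; apply: subset_centered_cube.
    have /KM/(_ _ Kx) /= xM : M < `|M| + 1.
      by rewrite (le_lt_trans (ler_norm M))// ltrDl.
    by rewrite (le_lt_trans xM)// /r ltrD2l ltr1n.
  apply: le_lt_trans (ltry (B * edge Q `^ delta * expR (delta * `|e|) / delta)).
  apply: choquet_le_exp => //.
    by rewrite !mulr_ge0 ?expR_ge0 ?powR_ge0.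
  move=> t t0; rewrite -[X in (_ <= X%:E)%E]mulrA -expRD mulNr -mulrBr.
  (* Local integrability on one large cube: for [t <= |e|] the content of the cube is enough, as
     [B >= 1] and the exponent is nonnegative; for larger [t], [|f x| > t] forces
     [|f x - e| > t - |e|]. *)
  have [te|et] := leP t `|e|.
    apply: (@le_trans _ _ (edge Q `^ delta)%:E).
      by apply: hcontent_le_cube => x [/KQ].
    rewrite lee_fin -[leLHS]mul1r -[leLHS]mulr1.
    apply: ler_pM => //; [by rewrite mul1r powR_ge0| |].
      by rewrite ler_wpM2r// powR_ge0.
    by rewrite -[1]expR0 ler_expR mulr_ge0 ?(ltW d0)// subr_ge0.
  apply: le_trans (le_trans (hcontent_le _ _ delta _ _ _) (He (t - `|e|) _)) _.
  - move=> x [/KQ Qx]; rewrite lte_fin => tf; split => //.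
    rewrite ltrBlDr (lt_le_trans tf)//.
    by rewrite -{1}(subrK e (f x)) ler_normD.
  - by rewrite subr_gt0.
  - by rewrite lee_fin mulNr -mulrN opprB.
apply: le_lt_trans (ltry (8 ^+ n * B / delta)).
apply: ge_ereal_sup => _ [Q _ <-]; have [e -> He] := HB Q.
exact: choquet_mean_le_exp.
Qed.

(** * The two inclusions *)

(** Almost optimal coverings of the two sets are interleaved, one on even and the other on odd
    indices. *)
Lemma hcontent_setU (R : realType) (n : nat) (delta : R) (A B : set 'rV[R]_n) :
  (hcontent delta (A `|` B) <= hcontent delta A + hcontent delta B)%E.
Proof.
have [Af|] := boolP (hcontent delta A \is a fin_num); last first.
  rewrite ge0_fin_numE ?hcontent_ge0// -leNgt leye_eq => /eqP ->.
  by rewrite addye ?leey// gt_eqF// (lt_le_trans _ (hcontent_ge0 _ _ _ _)).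
have [Bf|] := boolP (hcontent delta B \is a fin_num); last first.
  rewrite ge0_fin_numE ?hcontent_ge0// -leNgt leye_eq => /eqP ->.
  by rewrite addey ?leey// gt_eqF// (lt_le_trans _ (hcontent_ge0 _ _ _ _)).
apply/lee_addgt0Pr => e e0; have e20 : 0 < e / 2 by rewrite divr_gt0.
have [_ [D1 [Q1 [A1 ->]]] lt1] := lb_ereal_inf_adherent e20 Af.
have [_ [D2 [Q2 [B2 ->]]] lt2] := lb_ereal_inf_adherent e20 Bf.
apply: (@le_trans _ _ (\esum_(i in D1) ((edge (Q1 i) `^ delta)%R)%:E +
    \esum_(i in D2) ((edge (Q2 i) `^ delta)%R)%:E)%E); last first.
  apply: le_trans (leeD (ltW lt1) (ltW lt2)) _.
  by rewrite addeACA -EFinD -splitr.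
pose ev k := k.*2; pose od k := k.*2.+1.
pose Q k := if odd k then Q2 k./2 else Q1 k./2.
have Qev k : Q (ev k) = Q1 k by rewrite /Q /ev odd_double doubleK.
have Qod k : Q (od k) = Q2 k by rewrite /Q /od /= odd_double/= uphalf_double.
have evI : injective ev by exact: double_inj.
have odI : injective od by move=> i j [] /double_inj.
apply: ereal_inf_lbound; exists (ev @` D1 `|` od @` D2), Q; split.
  move=> x [/A1[i Di ix]|/B2[i Di ix]].
    by exists (ev i); [left; exists i|rewrite Qev].
  by exists (od i); [right; exists i|rewrite Qod].
rewrite (esumID (ev @` D1) (ev @` D1 `|` od @` D2)) => [|i _]; last first.
  by rewrite lee_fin powR_ge0.
rewrite (_ : (ev @` D1 `|` od @` D2) `&` (ev @` D1) = ev @` D1); last first.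
  by rewrite setIC; apply/setIidPl => x; left.
rewrite (_ : (ev @` D1 `|` od @` D2) `&` ~` (ev @` D1) = od @` D2); last first.
  apply/seteqP; split=> [x [[]//]|_ [j Dj <-]]; split; first by right; exists j.
  by case=> i _ /(congr1 odd); rewrite /ev /od /= !odd_double.
rewrite !esum_image; [|by move=> i j _ _ /odI|by move=> i j _ _ /evI].
by congr (_ + _)%E; apply: eq_esum => i _; rewrite ?Qev ?Qod.
Qed.

(** Cubes being right-closed, the point belongs to the cube of which it is the upper corner; edge
    [e ^ (1 / delta)] makes the cost exactly [e]. *)
Lemma hcontent_set1 (R : realType) (n : nat) (delta : R) (x : 'rV[R]_n) :
  0 < delta -> hcontent delta [set x] = 0%E.
Proof.
move=> d0; apply/eqP; rewrite eq_le hcontent_ge0 andbT.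
apply/lee_addgt0Pr => e e0; rewrite add0e.
have r0 : 0 < e `^ delta^-1 by rewrite powR_gt0.
pose Q := @Cube R n (\row_i (x ord0 i - e `^ delta^-1)) _ r0.
rewrite (_ : e = edge Q `^ delta); last first.
  by rewrite /= -powRrM mulVf ?gt_eqF// powRr1// ltW.
apply: hcontent_le_cube => _ -> i /=.
by rewrite mxE subrK lexx andbT ltrBlDr ltrDl.
Qed.

(** The essential infimum lies between [- M] and [M + 1], so an oscillation above [L = 2 * M + 1]
    occurs only on the null set where [|f| > M]. Below [L], the factor [expR (delta * L)] makes the
    trivial bound by the edge sufficient. *)
Lemma Linfty_sub_BLO (R : realType) (n : nat) (delta : R) :
  0 < delta -> delta <= n%:R -> @Linfty R n delta `<=` @BLO R n delta.
Proof.
move=> d0 dn f; rewrite /Linfty /Linfty_norm /= => /ereal_inf_lt.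
move=> [_ [M [M0 fM] <-] _].
have f0 (E : set 'rV[R]_n) :
    E `<=` [set x | M < `|f x|] -> hcontent delta E = 0%E.
  by move=> EM; apply/eqP; rewrite eq_le hcontent_ge0 andbT -fM hcontent_le.
pose L := 2 * M + 1; have L0 : 0 < L by rewrite /L; lra.
apply: (@BLO_exp_decay _ _ _ _ (expR (delta * L))) => //.
  by rewrite -[1]expR0 ler_expR mulr_ge0// ltW.
move=> Q.
have lb : ((- M)%:E <= essinf delta Q f)%E.
  apply: le_ereal_inf_tmp => _ [t /= + <-]; rewrite lee_fin.
  apply: contraPT; rewrite -ltNge => tM; rewrite f0 ?ltxx// => x [_ /= fx].
  by rewrite lter_normr; apply/orP; right; lra.
(* If [f < M + 1] held only on a null part of [Q], then [Q] would be a union of two null sets. The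
   margin 1 is there because the inequality defining [essinf] is strict. *)
have ub : (essinf delta Q f <= (M + 1)%:E)%E.
  apply: ereal_inf_lbound; exists (M + 1) => //=.
  rewrite lt_neqAle hcontent_ge0 andbT; apply/eqP => f1.
  have := hcontent_cube_gt0 _ _ _ Q d0 dn; rewrite ltNge => /negP; apply.
  apply: le_trans (hcontent_le _ _ _ _ _ _) (le_trans (hcontent_setU _ _ _
    [set x | cube_set Q x /\ f x < M + 1] [set x | M < `|f x|]) _).
    move=> x Qx; have [?|?] := ltP (f x) (M + 1); first by left.
    by right; rewrite /= (lt_le_trans _ (ler_norm _))//; lra.
  by rewrite -f1 fM adde0.
case: (essinf delta Q f) lb ub => [e| |]; rewrite ?leye_eq ?leeNy_eq//.
rewrite !lee_fin => Me eM; exists e => // t t0.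
have [Lt|tL] := leP L t.
  rewrite f0 ?lee_fin ?mulr_ge0 ?expR_ge0 ?powR_ge0// => x [_ /= tf].
  have := lt_le_trans (le_lt_trans Lt tf) (ler_normB _ _).
  have : `|e| <= M + 1 by rewrite ler_norml; lra.
  by rewrite /L; lra.
apply: (@le_trans _ _ (edge Q `^ delta)%:E).
  by apply: hcontent_le_cube => x [].
rewrite lee_fin mulrAC -expRD mulNr -mulrBr -[leLHS]mul1r ler_wpM2r ?powR_ge0//.
by rewrite -[1]expR0 ler_expR mulr_ge0 ?subr_ge0// ltW.
Qed.

(** A finite essential infimum is an admissible constant [c]; an infinite one makes the BLO mean
    infinite. *)
Lemma BLO_sub_BMO (R : realType) (n : nat) (delta : R) :
  0 < delta -> delta <= n%:R -> @BLO R n delta `<=` @BMO R n delta.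
Proof.
move=> d0 dn f [fl fB]; split => //; apply: le_lt_trans fB.
set S := ereal_sup (range (fun Q : cube R n => choquet_mean _ _ _)).
apply: ge_ereal_sup => _ [Q _ <-].
have QS :
    (choquet_mean delta Q (fun x => `|(f x)%:E - essinf delta Q f|) <= S)%E.
  by apply: ereal_sup_ubound; exists Q.
apply: le_trans QS; case: (essinf delta Q f) => [e| |].
- by apply: ereal_inf_lbound; exists e.
- by rewrite [leRHS]choquet_mean_infty ?leey.
- by rewrite [leRHS]choquet_mean_infty ?leey.
Qed.

(** Negation exchanges the constants [c] and [- c]. BLO has no such symmetry, which is what the
    logarithm exploits. *)
Lemma BMO_opp (R : realType) (n : nat) (delta : R) (f : 'rV[R]_n -> R) :
  BMO delta f -> BMO delta (fun x => - f x).
Proof.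
move=> [fl fB]; split.
  move=> K /fl.
  by under [X in _ -> (choquet _ _ X < _)%E]eq_fun do rewrite normrN.
apply: le_lt_trans fB; apply: ge_ereal_sup => _ [Q _ <-].
apply: (le_trans _ (ereal_sup_ubound (imageT _ Q))).
apply: le_ereal_inf_tmp => _ [c _ <-].
apply: ereal_inf_lbound; exists (- c) => //.
congr (choquet_mean _ _ _); apply/funext => x.
by rewrite -opprB normrN opprK addrC.
Qed.

(** * The logarithm of the norm as separating example *)

(** The origin is the excluded corner, so these cubes approach it while avoiding the default value
    of [ln] at 0. *)
Definition corner_cube (R : realType) (n : nat) (r : R) (r0 : 0 < r) :
  cube R n := @Cube R n 0 r r0.

Lemma corner_cube_norm (R : realType) (n : nat) (r : R) (r0 : 0 < r)
    (x : 'rV[R]_n) : (0 < n)%N ->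
  cube_set (corner_cube R n r r0) x -> 0 < `|x| <= r.
Proof.
move=> n0 Qx; apply/andP; split.
  have /andP[x0 _] := Qx (Ordinal n0); move: x0; rewrite mxE => x0.
  by rewrite (lt_le_trans x0)// (le_trans (ler_norm _))// coord_le_norm.
apply: norm_le_coord; first exact: ltW.
move=> i; have := Qx i; rewrite /= mxE add0r => /andP[x0 xr].
by rewrite ger0_norm// ltW.
Qed.

(** Each coordinate on [Q] lies between those of the extreme corners [a] and [b], so the one of
    larger norm serves as [p]. As [a] is not in [Q], the last clause supplies cubes inside [Q]
    arbitrarily close to [p]. *)
Lemma far_corner (R : realType) (n : nat) (Q : cube R n) : (0 < n)%N ->
  exists p : 'rV[R]_n, [/\ 0 < `|p|,
    forall x, cube_set Q x -> `|x| <= `|p|,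
    forall x, cube_set Q x -> `|x - p| <= edge Q &
    forall e, 0 < e -> exists2 Q', cube_set Q' `<=` cube_set Q &
      forall x, cube_set Q' x -> `|x - p| <= e].
Proof.
move=> n0; have l0 := edge_gt0 Q.
pose a := corner Q; pose b : 'rV[R]_n := \row_i (a ord0 i + edge Q).
(* Hence [a] and [b] are not both 0, and the larger norm is positive. *)
have lab : edge Q <= `|a| + `|b|.
  have /= := coord_le_norm R n (b - a) (Ordinal n0).
  rewrite !mxE addrC addKr gtr0_norm// => /le_trans; apply.
  by rewrite [leRHS]addrC ler_normB.
have Qab x : cube_set Q x -> `|x| <= Num.max `|a| `|b|.
  move=> Qx; apply: norm_le_coord; first by rewrite le_max normr_ge0.
  move=> i; have := Qx i; rewrite -/a => Qxi; rewrite le_max.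
  have := coord_le_norm R n a i; have := coord_le_norm R n b i; rewrite mxE.
  rewrite !ler_norml => bi ai.
  have [x0|x0] := leP 0 (x ord0 i); apply/orP; [right|left]; lra.
have Qa x : cube_set Q x -> `|x - a| <= edge Q.
  move=> Qx; apply: norm_le_coord; first exact: ltW.
  by move=> i; have := Qx i; rewrite !mxE ler_norml -/a; lra.
have Qb x : cube_set Q x -> `|x - b| <= edge Q.
  move=> Qx; apply: norm_le_coord; first exact: ltW.
  by move=> i; have := Qx i; rewrite !mxE ler_norml -/a; lra.
have me e (e0 : 0 < e) : 0 < Num.min e (edge Q) by rewrite lt_min e0.
have [ab|ba] := leP `|a| `|b|.
- exists b; split => //; first by lra.
    by move=> x /Qab; rewrite max_r.
  move=> e e0.
  exists (@Cube R n (\row_i (b ord0 i - Num.min e (edge Q))) _ (me e e0)).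
    move=> x Q'x i; have := Q'x i; rewrite /= !mxE -/a.
    by have : Num.min e (edge Q) <= edge Q; [rewrite ge_min lexx orbT|lra].
  move=> x Q'x; apply: norm_le_coord; first exact: ltW.
  move=> i; have := Q'x i; rewrite /= !mxE ler_norml -/a.
  by have : Num.min e (edge Q) <= e; [rewrite ge_min lexx|lra].
- exists a; split => //; first by lra.
    by move=> x /Qab; rewrite max_l// ltW.
  move=> e e0; exists (@Cube R n a _ (me e e0)).
    move=> x Q'x i; have := Q'x i; rewrite /= -/a.
    by have : Num.min e (edge Q) <= edge Q; [rewrite ge_min lexx orbT|lra].
  move=> x Q'x; apply: norm_le_coord; first exact: ltW.
  move=> i; have := Q'x i; rewrite /= !mxE ler_norml.
  by have : Num.min e (edge Q) <= e; [rewrite ge_min lexx|lra].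
Qed.

(* Since [ln 0 = 0], the value at the origin is irregular; the essential infimum
   does not see it because points have null content. *)
Lemma BLO_neg_ln (R : realType) (n : nat) (delta : R) :
  0 < delta -> delta <= n%:R -> BLO delta (fun x : 'rV[R]_n => - ln `|x|).
Proof.
move=> d0 dn.
have n0 : (0 < n)%N by rewrite -(ltr0n R) (lt_le_trans d0).
apply: (@BLO_exp_decay _ _ _ _ (4 `^ delta)) => //.
  by rewrite -[leLHS](powRr0 4) ler_powR ?ler1n// ltW.
move=> Q; have [p [p0 Qp Ql Q'p]] := far_corner _ _ Q n0.
have l0 := edge_gt0 Q.
have lnp x : cube_set Q x -> x != 0 -> ln `|x| <= ln `|p|.
  by move=> Qx x0; rewrite ler_ln ?posrE ?normr_gt0 ?Qp// -normr_gt0.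
exists (- ln `|p|).
  apply/eqP; rewrite eq_le; apply/andP; split.
    apply/lee_addgt0Pr => h h0; rewrite -EFinD.
    apply: ereal_inf_lbound; exists (- ln `|p| + h) => //=.
    (* Half the gap between [|p|] and [|p| * expR (- h)]: within this distance of [p], [- ln |x|]
       stays strictly below [- ln |p| + h]. *)
    have e0 : 0 < `|p| * (1 - expR (- h)) / 2.
      rewrite divr_gt0// mulr_gt0// subr_gt0 -[ltRHS]expR0 ltr_expR.
      by rewrite oppr_lt0.
    have [Q' Q'Q Q'e] := Q'p _ e0.
    apply: lt_le_trans (hcontent_cube_gt0 _ _ _ Q' d0 dn) _.
    apply: hcontent_le => x Q'x; split; first exact: Q'Q.
    have xp : `|p| * expR (- h) < `|x|.
      have := lerB_dist p x; rewrite distrC => px.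
      have := Q'e _ Q'x; move: px e0; rewrite mulrBr mulr1; lra.
    have : ln (`|p| * expR (- h)) < ln `|x|.
      have pe0 : 0 < `|p| * expR (- h) by rewrite mulr_gt0 ?expR_gt0.
      by rewrite ltr_ln ?posrE// (lt_trans pe0).
    by rewrite lnM ?posrE ?expR_gt0// expRK; lra.
  apply: le_ereal_inf_tmp => _ [t /= + <-]; rewrite lee_fin.
  apply: contraPT; rewrite -ltNge => tp.
  apply/negP; rewrite -leNgt -(hcontent_set1 R n delta 0 d0) hcontent_le//.
  move=> x [Qx /= xt]; apply/eqP/negPn/negP => x0.
  by have := lnp _ Qx x0; lra.
move=> t t0; set E := [set x | _].
have xE x : E x -> cube_set Q x /\ `|x| < `|p| * expR (- t).
  move=> [Qx tx]; split => //.
  have [->|x0] := eqVneq x 0; first by rewrite normr0 mulr_gt0 ?expR_gt0.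
  have lx := lnp _ Qx x0.
  move: tx; rewrite /= ger0_norm => [tx|]; last by lra.
  rewrite -ltr_ln ?posrE ?normr_gt0 ?mulr_gt0 ?expR_gt0//.
  by rewrite lnM ?posrE ?expR_gt0// expRK; lra.
have [->|/set0P[y /xE[Qy yt]]] := eqVneq E set0.
  apply: le_trans (hcontent_le _ _ _ _ [set 0] _) _ => //.
  by rewrite hcontent_set1// lee_fin !mulr_ge0 ?powR_ge0 ?expR_ge0.
have -> : 4 `^ delta * edge Q `^ delta * expR (- delta * t) =
    (4 * edge Q * expR (- t)) `^ delta.
  rewrite !powRM ?mulr_ge0 ?expR_ge0 ?(ltW l0)//.
  rewrite [expR (- t) `^ _]/powR gt_eqF ?expR_gt0// expRK.
  by rewrite mulrN mulNr.
(* In the first case the cube centered at 0 has edge [2 * |p| * expR (- t)], at most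
   [4 * edge Q * expR (- t)]: hence the constant 4. *)
have [pl|lp] := leP `|p| (2 * edge Q).
  have r0 : 0 < `|p| * expR (- t) by rewrite mulr_gt0 ?expR_gt0.
  apply: (@le_trans _ _ (edge (centered_cube _ n 0 _ r0) `^ delta)%:E).
    by apply: hcontent_le_cube => x /xE[_]; exact: subset_centered_cube.
  rewrite lee_fin /= ge0_ler_powR ?nnegrE ?addr_ge0 ?mulr_ge0 ?expR_ge0//.
  - exact: ltW.
  - by rewrite ltW.
  - by rewrite -mulrDl ler_wpM2r ?expR_ge0//; lra.
(* Away from the origin, the point [y] of [E] gives [|p| / 2 < |y| < |p| * expR (- t)], so
   [4 * expR (- t) > 1] and covering by [Q] itself is enough. *)
apply: (@le_trans _ _ (edge Q `^ delta)%:E).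
  by apply: hcontent_le_cube => x /xE[].
rewrite lee_fin ge0_ler_powR ?nnegrE ?mulr_ge0 ?expR_ge0 ?(ltW d0) ?(ltW l0)//.
have py := Ql _ Qy; have := lerB_dist p y.
rewrite distrC => ppy.
have : 2^-1 < expR (- t).
  rewrite -(ltr_pM2l p0) (le_lt_trans _ yt)//; lra.
by move=> et; rewrite -mulrA mulrCA -[leLHS]mulr1 ler_pM2l//; lra.
Qed.

Lemma neg_ln_notin_Linfty (R : realType) (n : nat) (delta : R) :
  0 < delta -> delta <= n%:R -> ~ Linfty delta (fun x : 'rV[R]_n => - ln `|x|).
Proof.
move=> d0 dn; have n0 : (0 < n)%N by rewrite -(ltr0n R) (lt_le_trans d0).
rewrite /Linfty /Linfty_norm /= => /ereal_inf_lt[_ [t [t0 ft] _] _].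
(* On the corner cube of this edge [- ln |x|] is at least [t + 1], yet the cube has positive
   content. *)
have r0 := expR_gt0 (- (t + 1)).
have := hcontent_cube_gt0 _ _ _ (corner_cube R n _ r0) d0 dn.
rewrite ltNge => /negP; apply; rewrite -ft; apply: hcontent_le => x.
move=> /(corner_cube_norm _ _ _ _ _ n0)/andP[x0 xr] /=.
have : ln `|x| <= - (t + 1) by rewrite -[leRHS]expRK ler_ln ?posrE.
by move=> lx; rewrite ltr_normr; apply/orP; left; lra.
Qed.

Lemma ln_notin_BLO (R : realType) (n : nat) (delta : R) :
  0 < delta -> delta <= n%:R -> ~ BLO delta (fun x : 'rV[R]_n => ln `|x|).
Proof.
move=> d0 dn; have n0 : (0 < n)%N by rewrite -(ltr0n R) (lt_le_trans d0).
move=> [_]; apply/negP; rewrite -leNgt leye_eq; apply/eqP.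
pose Q := corner_cube R n 1 ltr01.
apply: ereal_supy; exists Q => //; apply: choquet_mean_infty => //.
suff -> : essinf delta Q (fun x => ln `|x|) = -oo%E by [].
apply: eq_ninfty => t; apply: ereal_inf_lbound; exists t => //=.
(* The minimum with 1 keeps the small cube inside [Q]; the other term forces [ln |x| <= t - 1],
   strictly below [t]. *)
have r0 : 0 < Num.min 1 (expR (t - 1)) by rewrite lt_min ltr01 expR_gt0.
apply: lt_le_trans (hcontent_cube_gt0 _ _ _ (corner_cube R n _ r0) d0 dn) _.
apply: hcontent_le => x Q'x; split.
  move=> i; have := Q'x i; rewrite /= => /andP[-> /le_trans]; apply.
  by rewrite lerD2l ge_min lexx.
have /andP[x0] := corner_cube_norm _ _ _ _ _ n0 Q'x.
rewrite le_min => /andP[_ xt].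
have : ln `|x| <= t - 1 by rewrite -[leRHS]expRK ler_ln ?posrE ?expR_gt0.
by move=> /le_lt_trans; apply; rewrite ltrBlDr ltrDl.
Qed.

Theorem proposition5p1 (R : realType) (n : nat) (delta : R)
    (delta_gt0 : 0 < delta) (delta_le : delta <= n%:R) :
  @Linfty R n delta `<` @BLO R n delta /\
  @BLO R n delta `<` @BMO R n delta.
Proof.
split; split.
- exact: Linfty_sub_BLO.
- move=> /(_ _ (BLO_neg_ln _ _ _ delta_gt0 delta_le)).
  exact: neg_ln_notin_Linfty.
- exact: BLO_sub_BMO.
- have /BMO_opp := BLO_sub_BMO _ _ _ delta_gt0 delta_le _
    (BLO_neg_ln _ _ _ delta_gt0 delta_le).
  rewrite (_ : (fun x => - - _) = fun x => ln `|x|); last first.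
    by apply/funext => x; rewrite opprK.
  by move=> lnBMO /(_ _ lnBMO); exact: ln_notin_BLO.
Qed.
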